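(* There is an absolute constant $c>0$ such that the following holds. Let $G$ be any graph with treewidth $w$ and maximum degree $d \ge 1$. Then every MWIS-circuit of $G$ has at least $2^{c\,w/d}$ gates.
   Context: A tropical circuit over a set of variables $X$ is a finite directed acyclic graph whose vertices (gates) have in-degree $0$ or $2$; each in-degree-$0$ gate is labeled by a variable of $X$ or by the constant $0$, each in-degree-$2$ gate is labeled by $\max$ or $+$, and one gate is designated the output gate. It computes, over the tropical semiring $(\mathbb{R}\cup\{-\infty\},\max,+)$ (where $\max$ acts as addition and $+$ as multiplication, with unit $0$), a tropical polynomial: formally each gate computes a set of monomials (finite multisets of variables): a leaf labeled $x$ computes $\{x\}$, a leaf labeled $0$ computes the empty monomial, a $\max$ gate computes the union of its children's monomial sets, and a $+$ gate computes all products (multiset unions) of a monomial of one child with a monomial of the other. For a graph $G$, an MWIS-polynomial of $G$ is a tropical polynomial $f$ in the variables $V(G)$ such that (1) every monomial of $f$ is of the form $v_1\cdots v_l$ with $\{v_1,\dots,v_l\}$ an independent set of $G$ (distinct vertices), and (2) for every independent set $\{v_1,\dots,v_l\}$ of $G$, including the empty set (the empty monomial), the monomial $v_1\cdots v_l$ occurs in $f$. An MWIS-circuit of $G$ is a tropical circuit over $V(G)$ computing an MWIS-polynomial of $G$ (equivalently, it outputs the weight of a maximum weight independent set of $G$ for every real weight assignment to the vertices). *)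

(* Defs.v *)
From HB Require Import structures.
From mathcomp Require Import all_boot.
From mathcomp Require Import finmap multiset.

Set Implicit Arguments.
Unset Strict Implicit.
Unset Printing Implicit Defensive.

Local Open Scope nat_scope.
Local Open Scope mset_scope.

Record sgraph := SGraph {
  vertex :> finType;
  adj : rel vertex;
  adj_sym : symmetric adj;
  adj_irrefl : irreflexive adj
}.

Definition degree (G : sgraph) (v : G) : nat := #|[set u | adj v u]|.

Definition max_degree (G : sgraph) : nat := \max_(v : G) degree v.

Definition independent (G : sgraph) (S : {set G}) : Prop :=
  forall u v, u \in S -> v \in S -> ~~ adj u v.

(* A cycle of a simple graph has at least three vertices; [ucycle] also
   accepts the degenerate cycle [:: x; y] traversing an edge back and forth. *)
Definition is_tree (T : sgraph) : Prop :=
  [/\ 0 < #|T|,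
      forall s t : T, connect (@adj T) s t
    & forall c : seq T, ucycle (@adj T) c -> size c <= 2].

Record tree_decomposition (G : sgraph) := TreeDecomposition {
  td_tree : sgraph;
  td_bag : td_tree -> {set G};
  td_is_tree : is_tree td_tree;
  td_vertex : forall v : G, exists t, v \in td_bag t;
  td_edge : forall u v : G, adj u v ->
    exists t, (u \in td_bag t) && (v \in td_bag t);
  td_connected : forall (v : G) (s t : td_tree),
    v \in td_bag s -> v \in td_bag t ->
    connect [rel a b | [&& adj a b, v \in td_bag a & v \in td_bag b]] s t
}.

(* Predecessor is truncated: the vertexless graph gets width 0, not -1. *)
Definition td_width (G : sgraph) (D : tree_decomposition G) : nat :=
  (\max_(t : td_tree D) #|td_bag t|).-1.

Definition is_treewidth (G : sgraph) (w : nat) : Prop :=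
  (exists D : tree_decomposition G, td_width D = w) /\
  (forall D : tree_decomposition G, w <= td_width D).

Inductive gate_label (X gate : Type) :=
| LVar of X
| LZero
| LMax of gate & gate
| LPlus of gate & gate.
Arguments LZero {X gate}.

Definition is_input (X : Type) (gate : eqType)
    (label : gate -> gate_label X gate) : rel gate :=
  fun g h => match label g with
             | LVar _ | LZero => false
             | LMax h1 h2 | LPlus h1 h2 => (h == h1) || (h == h2)
             end.

Record circuit (X : Type) := Circuit {
  gate : finType;
  label : gate -> gate_label X gate;
  output : gate;
  circuit_acyclic : forall c : seq gate, cycle (is_input label) c -> c = [::]
}.

Definition num_gates (X : Type) (C : circuit X) : nat := #|gate C|.

Inductive computes (X : choiceType) (C : circuit X) :
    gate C -> {mset X} -> Prop :=
| computes_var g x : label g = LVar _ x -> computes g [mset x]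
| computes_zero g : label g = LZero -> computes g mset0
| computes_maxl g h1 h2 m :
    label g = LMax _ h1 h2 -> computes h1 m -> computes g m
| computes_maxr g h1 h2 m :
    label g = LMax _ h1 h2 -> computes h2 m -> computes g m
| computes_plus g h1 h2 m1 m2 :
    label g = LPlus _ h1 h2 -> computes h1 m1 -> computes h2 m2 ->
    computes g (m1 `+` m2).

Definition mset_of_set (V : finType) (S : {set V}) : {mset V} :=
  seq_mset (enum S).

Definition is_MWIS_polynomial (G : sgraph) (f : {mset G} -> Prop) : Prop :=
  (forall m, f m -> exists2 S : {set G}, independent S & m = mset_of_set S) /\
  (forall S : {set G}, independent S -> f (mset_of_set S)).

Definition is_MWIS_circuit (G : sgraph) (C : circuit G) : Prop :=
  is_MWIS_polynomial (@computes G C (output C)).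

(* Main.v *)
Require Import Defs.
From mathcomp Require Import all_boot all_order all_algebra.
From mathcomp Require Import finmap multiset zify ring lra.
From mathcomp Require Import interval_inference boolp reals sequences exp.

(** A gate [h] together with the part of the circuit outside it yields disjoint,
    non-adjacent vertex sets [A] and [B]: the vertices occurring in monomials of
    [h], and those occurring in its contexts. Treewidth above [4 s] provides a
    set [W] of [3 s + 1] vertices such that every such pair splitting [W] in a
    balanced way leaves more than [s] vertices uncovered. Following the parse
    tree of the monomial of an independent set [I] down to a balanced pair, we
    find that [I] avoids one of at most [N ^ 2] separators, where [N] is the
    number of gates. On the other hand, under the hard-core measure of fugacity
    [1 / (2 d)], a separator of size [k] is avoided with probability at most
    [(1 + 1 / (4 d)) ^- k]; hence [N ^ 2 >= 2 `^ (w / (16 d))]. *)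

Set Implicit Arguments.
Unset Strict Implicit.
Unset Printing Implicit Defensive.
Import Order.TTheory GRing.Theory Num.Theory.
Local Open Scope nat_scope.

(** * Finite sets *)

Section FiniteSets.
Variable T : finType.
Implicit Types A B U W : {set T}.

Lemma setU1_ind (P : {set T} -> Prop) :
  P set0 -> (forall x A, x \notin A -> P A -> P (x |: A)) -> forall A, P A.
Proof.
move=> P0 PU1 A; have [n] := ubnP #|A|; elim: n A => // n IHn A leAn.
have [->//|[x xA]] := set_0Vmem A.
rewrite -(setD1K xA); apply: PU1; first by rewrite !inE eqxx.
by apply: IHn; move: leAn; rewrite (cardsD1 x A) xA.
Qed.

Lemma exists_set_between_card U W m : W \subset U -> #|W| <= m <= #|U| ->
  exists W', [/\ W \subset W', W' \subset U & #|W'| = m].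
Proof.
move=> sWU /andP[leWm lemU].
have : 0 < #|[set A : {set T} | A \subset U :\: W & #|A| == m - #|W|]|.
  by rewrite cards_draws bin_gt0 cardsDS // leq_sub2r.
move=> /card_gt0P[A]; rewrite inE subsetD => /andP[/andP[sAU dAW] /eqP cardA].
exists (W :|: A); split; [exact: subsetUl | by rewrite subUset sWU sAU |].
by rewrite cardsU setIC (disjoint_setI0 dAW) cards0 subn0 cardA subnKC.
Qed.

Lemma leq_card_setI_disjoint A B W :
  [disjoint A & B] -> #|A :&: W| + #|B :&: W| <= #|W|.
Proof.
move=> dAB; rewrite -cardsUI -setIUl setIACA setIid (disjoint_setI0 dAB).
by rewrite set0I cards0 addn0 subset_leq_card // subsetIr.
Qed.

Lemma leq_card_setI_cover A B W :
  #|W| <= #|A :&: W| + #|B :&: W| + #|~: (A :|: B)|.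
Proof.
have sub : W \subset (A :&: W) :|: (B :&: W) :|: ~: (A :|: B).
  apply/subsetP => x xW; rewrite !inE xW !andbT.
  by case: (x \in A); case: (x \in B).
apply: leq_trans (subset_leq_card sub) _.
apply: leq_trans (leq_card_setU _ _) _.
by rewrite leq_add2r leq_card_setU.
Qed.

End FiniteSets.

(** * Rooted trees *)

Record rooted_tree := RootedTree {
  rt_node :> finType;
  rt_root : rt_node;
  rt_parent : rt_node -> rt_node;
  rt_depth : rt_node -> nat;
  rt_depth_parent : forall x, x != rt_root ->
    rt_depth (rt_parent x) < rt_depth x
}.

Section RootedTree.
Variable T : rooted_tree.
Local Notation root := (rt_root T).
Local Notation parent := (@rt_parent T).
Local Notation depth := (@rt_depth T).

Definition rooted_adj : rel T :=
  [rel x y | ((x != root) && (parent x == y)) ||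
             ((y != root) && (parent y == x))].

Lemma rooted_adj_sym : symmetric rooted_adj.
Proof. by move=> x y; rewrite /rooted_adj /= orbC. Qed.

Lemma rooted_adj_irrefl : irreflexive rooted_adj.
Proof.
move=> x; rewrite /rooted_adj /= orbb; apply/negP.
move=> /andP[/rt_depth_parent + /eqP pxx].
by rewrite pxx ltnn.
Qed.

Definition rooted_sgraph : sgraph := SGraph rooted_adj_sym rooted_adj_irrefl.

Definition subtree (P : pred T) : Prop :=
  exists2 t, P t & forall x, P x -> x != t -> (x != root) && P (parent x).

Lemma subtree_rootP (P : pred T) : P root ->
  subtree P <-> (forall x, x != root -> P x -> P (parent x)).
Proof.
move=> Proot; split=> [[t _ up] x xr Px|up]; last first.
  by exists root => // x Px xr; rewrite xr up.
have tr : root = t by apply/eqP/negPn/negP => /(up _ Proot); rewrite eqxx.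
by have /andP[] : (x != root) && P (parent x) by apply: up; rewrite // -tr.
Qed.

Lemma subtree_connect (P : pred T) x y : subtree P -> P x -> P y ->
  connect [rel a b | [&& rooted_adj a b, P a & P b]] x y.
Proof.
move=> [t _ up]; set e := [rel a b | _].
have to_top z : P z -> connect e z t.
  have [n] := ubnP (depth z); elim: n z => // n IHn z lt_zn Pz.
  have [->|zt] := eqVneq z t; first exact: connect0.
  have /andP[zr Ppz] := up z Pz zt.
  apply: connect_trans (IHn (parent z) _ Ppz).
    by apply: connect1; rewrite /e /rooted_adj /= zr eqxx Pz Ppz.
  by rewrite -ltnS (leq_trans _ lt_zn) // ltnS rt_depth_parent.
move=> Px Py; apply: connect_trans (to_top x Px) _.
rewrite sym_connect_sym; first exact: to_top Py.
by move=> a b /=; rewrite rooted_adj_sym [P a && _]andbC.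
Qed.

(* The two neighbours on a cycle of a vertex of maximal depth are its parent. *)
Lemma rooted_cycle_size (c : seq T) : ucycle rooted_adj c -> size c <= 2.
Proof.
move=> /andP[cyc_c uniq_c]; rewrite leqNgt; apply/negP => size_c.
have [x0 x0c] : exists x0, x0 \in c.
  by case: c size_c {cyc_c uniq_c} => // a c _; exists a; rewrite mem_head.
case: (@arg_maxnP _ x0 (mem c) depth x0c) => x xc xmax.
have [i c' rot_c] := rot_to xc.
move: cyc_c uniq_c size_c; rewrite -(rot_cycle i) -(rot_uniq i) -(size_rot i).
have {}xmax y : y \in x :: c' -> depth y <= depth x.
  by rewrite -rot_c mem_rot => /xmax.
have nbr_parent y : y \in x :: c' -> rooted_adj x y -> parent x = y.
  move=> yc /orP[/andP[_ /eqP//]|/andP[/rt_depth_parent + /eqP pyx]].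
  by rewrite pyx ltnNge xmax.
rewrite rot_c; case: c' {rot_c i xc} xmax nbr_parent => [|y [|z c']] //= xmax.
move=> nbr_parent; rewrite rcons_path.
move=> /andP[xy /andP[_ /andP[_ lx]]] /and3P[_ yzc _] _.
have pxy : parent x = y by apply: nbr_parent => //; rewrite !inE eqxx orbT.
have pxl : parent x = last z c'.
  apply: nbr_parent; first by rewrite 2!in_cons mem_last !orbT.
  by rewrite rooted_adj_sym.
by move: yzc; rewrite -pxy pxl mem_last.
Qed.

Lemma rooted_sgraph_is_tree : is_tree rooted_sgraph.
Proof.
split; [by apply/card_gt0P; exists root | | exact: rooted_cycle_size].
move=> s t; have full : subtree predT by apply/subtree_rootP.
apply: connect_sub (subtree_connect full (isT : predT s) (isT : predT t)).
by move=> x y /andP[xy _]; exact: connect1.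
Qed.

End RootedTree.

Section Graft.
Variables (I : finType) (T : I -> rooted_tree).

Definition graft_parent (x : option {i & T i}) : option {i & T i} :=
  if x is Some (existT i y) then
    if y == rt_root (T i) then None else Some (Tagged T (rt_parent y))
  else None.

Definition graft_depth (x : option {i & T i}) : nat :=
  if x is Some (existT i y) then (rt_depth y).+1 else 0.

Lemma graft_depth_parent x : x != None ->
  graft_depth (graft_parent x) < graft_depth x.
Proof.
case: x => [[i y]|] //= _.
by case: eqVneq => //= yr; rewrite ltnS rt_depth_parent.
Qed.

Definition graft : rooted_tree := RootedTree graft_depth_parent.

Lemma subtree_graft_root (P : pred graft) : P None ->
  (forall i x, P (Some (Tagged T x)) -> x != rt_root (T i) ->
    P (Some (Tagged T (rt_parent x)))) ->
  subtree P.
Proof.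
move=> PNone up; apply/subtree_rootP => // -[[i y]|] //= _ Py.
by case: eqVneq => // yr; exact: up.
Qed.

Lemma subtree_graft_branch (i : I) (P : pred graft) :
  (forall x, P x -> exists y : T i, x = Some (Tagged T y)) ->
  subtree [pred y : T i | P (Some (Tagged T y))] -> subtree P.
Proof.
move=> in_branch [t Pt up]; exists (Some (Tagged T t)) => // x Px.
have [y eq_x] := in_branch x Px; rewrite eq_x in Px * => yt.
have /andP[yr Ppy] : (y != rt_root (T i)) && P (Some (Tagged T (rt_parent y))).
  by apply: up => //; apply: contraNneq yt => ->.
by rewrite /= (negbTE yr).
Qed.

End Graft.

(** * Treewidth and balanced separators *)

Section Treewidth.
Variable G : sgraph.
Implicit Types A B U W : {set G}.

Record bagged_tree := BaggedTree {
  bt_tree :> rooted_tree;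
  bag : bt_tree -> {set G}
}.

Definition occurrences (D : bagged_tree) (v : G) : pred D :=
  [pred x | v \in bag x].

Definition rooted_decomposition U (D : bagged_tree) : Prop :=
  [/\ forall x : D, bag x \subset U,
      forall u v, u \in U -> v \in U -> adj u v ->
        exists x : D, (u \in bag x) && (v \in bag x)
    & forall v, v \in U -> subtree (@occurrences D v)].

Definition decomposable U W k : Prop :=
  exists D, [/\ rooted_decomposition U D, forall x : D, #|bag x| <= k
    & W \subset bag (rt_root D)].

Lemma decomposable_subset U W W' k :
  W \subset W' -> decomposable U W' k -> decomposable U W k.
Proof.
move=> sWW' [D [decD leDk rootD]]; exists D; split=> //.
exact: subset_trans rootD.
Qed.

Lemma decomposable_leaf U W k :
  #|U| <= k -> W \subset U -> decomposable U W k.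
Proof.
move=> leUk sWU; have depth_unit (x : unit) : x != tt -> 0 < 0 by case: x.
exists (@BaggedTree (@RootedTree unit tt id (fun=> 0) depth_unit) (fun=> U)).
split=> //; split=> //= [u v uU vU _|v vU]; first by exists tt; rewrite uU vU.
exact/subtree_rootP.
Qed.

Lemma decomposable_graft (I : finType) (U : I -> {set G}) W k :
  W \subset \bigcup_i U i -> #|W| <= k ->
  (forall i j, i != j -> U i :&: U j \subset W) ->
  (forall u v, u \in \bigcup_i U i -> v \in \bigcup_i U i -> adj u v ->
    exists i, (u \in U i) && (v \in U i)) ->
  (forall i, decomposable (U i) (W :&: U i) k) ->
  decomposable (\bigcup_i U i) W k.
Proof.
move=> sWU leWk overlap edges /choice[D decD].
pose graft_bag (x : graft D) : {set G} :=
  if x is Some (existT i y) then bag (y : D i) else W.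
have bag_sub i (y : D i) v : v \in bag y -> v \in U i.
  by have [[sub _ _] _ _] := decD i; exact/subsetP/sub.
exists (@BaggedTree (graft D) graft_bag); split=> //=; last first.
  by case=> [[i y]|] //=; have [_ leDk _] := decD i.
split=> /= [[[i y]|] //=|u v uU vU uv|v /bigcupP[i _ vi]].
- have [[sub _ _] _ _] := decD i.
  exact: subset_trans (sub y) (bigcup_sup i _).
- have [i /andP[ui vi]] := edges u v uU vU uv.
  have [[_ edge _] _ _] := decD i; have [y uvy] := edge u v ui vi uv.
  by exists (Some (Tagged D y)).
have [vW|vW] := boolP (v \in W).
  apply: subtree_graft_root => //= j x vx xr.
  have [[_ _ tree] _ /subsetP rootW] := decD j; have vj := bag_sub j x v vx.
  have v_root : v \in bag (rt_root (D j)) by rewrite rootW // inE vW.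
  have /(subtree_rootP (P := @occurrences (D j) v) v_root) up := tree v vj.
  exact: up.
apply: (@subtree_graft_branch _ _ i); last first.
  by have [[_ _ tree] _ _] := decD i; exact: tree.
case=> [[j y]|] vy; last by case/negP: vW.
have [ij|ij] := eqVneq j i; first by case: _ / ij y vy => y _; exists y.
case/negP: vW; apply: (subsetP (overlap j i ij)).
by rewrite inE vi (bag_sub j y).
Qed.

Lemma treewidth_le_decomposable W k w :
  decomposable [set: G] W k -> is_treewidth G w -> w <= k.-1.
Proof.
move=> [D [[_ edge tree] leDk _]] [_ tw_le].
have vertex (v : G) : exists x : rooted_sgraph D, v \in bag (x : D).
  by have [x vx _] := tree v (in_setT v); exists x.
have connected (v : G) (x y : rooted_sgraph D) :
    v \in bag (x : D) -> v \in bag (y : D) ->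
    connect [rel a b : rooted_sgraph D |
               [&& adj a b, v \in bag (a : D) & v \in bag (b : D)]] x y.
  exact: subtree_connect (tree v (in_setT v)).
have edge_bag (u v : G) : adj u v ->
    exists x : rooted_sgraph D, (u \in bag (x : D)) && (v \in bag (x : D)).
  by apply: edge; rewrite inE.
apply: leq_trans (tw_le
  (TreeDecomposition (rooted_sgraph_is_tree D) vertex edge_bag connected)) _.
have : \max_(x : D) #|bag x| <= k by apply/bigmax_leqP.
by rewrite /td_width /=; lia.
Qed.

Definition separation A B : Prop :=
  [disjoint A & B] /\ forall u v, u \in A -> v \in B -> ~~ adj u v.

Lemma separation_sym A B : separation A B -> separation B A.
Proof.
move=> [dAB nadj]; split=> [|u v uB vA]; first by rewrite disjoint_sym.
by rewrite adj_sym nadj.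
Qed.

Definition light W A : bool := 3 * #|A :&: W| <= 2 * #|W|.

Definition balanced_separation W A B : Prop :=
  [/\ separation A B, light W A & light W B].

Lemma balanced_separation_sym W A B :
  balanced_separation W A B -> balanced_separation W B A.
Proof. by case=> sep lA lB; split=> //; exact: separation_sym. Qed.

Lemma decomposable_separation U W A B k :
  separation A B -> W \subset U -> U :\: (A :|: B) \subset W -> #|W| <= k ->
  decomposable (U :\: B) (W :\: B) k -> decomposable (U :\: A) (W :\: A) k ->
  decomposable U W k.
Proof.
move=> [dAB nadj] sWU sepW leWk decB decA.
pose side (b : bool) := if b then B else A.
have cover : \bigcup_b (U :\: side b) = U.
  by rewrite big_bool /= -setDIr setIC (disjoint_setI0 dAB) setD0.
have cut v : v \in U -> v \notin A -> v \notin B -> v \in W.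
  by move=> vU vA vB; apply: (subsetP sepW); rewrite !inE vU negb_or vA vB.
rewrite -cover; apply: decomposable_graft; rewrite ?cover //.
- move=> [] [] //= _; apply/subsetP => v; rewrite !inE.
    by move=> /andP[/andP[vB vU] /andP[vA _]]; exact: cut.
  by move=> /andP[/andP[vA vU] /andP[vB _]]; exact: cut.
- move=> u v uU vU uv; suff [b ub vb] :
      exists2 b, u \notin side b & v \notin side b.
    by exists b; rewrite !inE uU vU ub vb.
  have [uA|uA] := boolP (u \in A).
    exists true; first by rewrite (disjointFr dAB uA).
    by apply: contraTN uv => /(nadj _ _ uA).
  have [vA|vA] := boolP (v \in A); last by exists false.
  exists true; last by rewrite (disjointFr dAB vA).
  by apply: contraTN uv => /(nadj _ _ vA); rewrite adj_sym.
by case; rewrite setIDA (setIidPl sWU).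
Qed.

Lemma balanced_separation_meets W A B : balanced_separation W A B ->
  3 * #|~: (A :|: B)| < #|W| -> 0 < #|B :&: W|.
Proof.
move=> [_ + _]; have := leq_card_setI_cover A B W.
by rewrite /light; lia.
Qed.

Lemma balanced_separation_boundary U W A B : balanced_separation W A B ->
  3 * #|~: (A :|: B)| <= #|W| -> #|(W :|: U :\: (A :|: B)) :\: B| <= #|W|.
Proof.
move=> [_ lightA _] le_sep.
have sub : (W :|: U :\: (A :|: B)) :\: B \subset (A :&: W) :|: ~: (A :|: B).
  apply/subsetP => x; rewrite !inE => /andP[/negbTE-> /orP[xW|/andP[xA _]]].
    by rewrite xW orbF; case: (x \in A).
  by rewrite xA orbT.
have := leq_trans (subset_leq_card sub) (leq_card_setU _ _).
by move: lightA; rewrite /light; lia.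
Qed.

(* Robertson and Seymour: recursively split a [U] rooted at a bag [W] of
   [m] vertices along a separation balanced with respect to [W]. *)
Lemma balanced_separations_decomposable m s : 3 * s < m ->
  (forall W, #|W| = m ->
    exists A B, balanced_separation W A B /\ #|~: (A :|: B)| <= s) ->
  forall U W, W \subset U -> #|W| <= m -> decomposable U W (m + s).
Proof.
move=> lt_sm separable U; have [n] := ubnP #|U|.
elim: n U => // n IHn U ltUn W sWU leWm.
have [leUm|ltmU] := leqP #|U| m; first by apply: decomposable_leaf => //; lia.
have [W' [sWW' sW'U cardW']] :
    exists W', [/\ W \subset W', W' \subset U & #|W'| = m].
  by apply: exists_set_between_card; rewrite // leWm ltnW.
apply: decomposable_subset sWW' _.
have [A [B [balanced leS]]] := separable W' cardW'.
have branch X Y : balanced_separation W' X Y -> #|~: (X :|: Y)| <= s ->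
    decomposable (U :\: Y) ((W' :|: U :\: (X :|: Y)) :\: Y) (m + s).
  move=> balXY le_s; have lt_XY : 3 * #|~: (X :|: Y)| < #|W'| by lia.
  have /card_gt0P[y /setIP[yY yW]] := balanced_separation_meets balXY lt_XY.
  apply: IHn.
  - rewrite -ltnS; apply: leq_trans ltUn; rewrite ltnS; apply: proper_card.
    apply/properP; split; first exact: subsetDl.
    by exists y; rewrite ?(subsetP sW'U) // !inE yY.
  - by rewrite setSD // subUset sW'U subsetDl.
  - by rewrite -cardW'; apply: balanced_separation_boundary balXY (ltnW lt_XY).
apply: decomposable_subset (subsetUl W' (U :\: (A :|: B))) _.
have [sep _ _] := balanced; apply: decomposable_separation sep _ _ _ _ _.
- by rewrite subUset sW'U subsetDl.
- exact: subsetUr.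
- apply: leq_trans (leq_card_setU _ _) _; rewrite cardW' leq_add2l.
  by apply: leq_trans leS; rewrite subset_leq_card // setDE subsetIr.
- exact: branch balanced leS.
rewrite [A :|: B]setUC in leS *.
exact: branch (balanced_separation_sym balanced) leS.
Qed.

Lemma treewidth_unbreakable_set w s : is_treewidth G w -> 4 * s < w ->
  exists2 W : {set G}, #|W| = 3 * s + 1 &
    forall A B, balanced_separation W A B -> s < #|~: (A :|: B)|.
Proof.
move=> tw lt_sw; apply: contrapT => breakable.
have dec : decomposable [set: G] set0 (3 * s + 1 + s).
  apply: balanced_separations_decomposable; rewrite ?sub0set ?cards0 //.
    lia.
  move=> W cardW; apply: contrapT => unbreakable; apply: breakable.
  exists W => // A B sep; rewrite ltnNge; apply/negP => le_s.
  by apply: unbreakable; exists A, B.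
have := treewidth_le_decomposable dec tw; lia.
Qed.

End Treewidth.

(** * Parse trees of tropical circuits *)

Section Contexts.
Local Open Scope mset_scope.
Variables (X : choiceType) (C : circuit X).
Implicit Types (g h k : gate C) (m r : {mset X}).

(* [context g r] when some parse tree of the circuit has [g] as a node and [r]
   as the product of all its leaves that do not lie below that node. *)
Inductive context : gate C -> {mset X} -> Prop :=
| context_output : context (output C) mset0
| context_maxl g h1 h2 r :
    label g = LMax _ h1 h2 -> context g r -> context h1 r
| context_maxr g h1 h2 r :
    label g = LMax _ h1 h2 -> context g r -> context h2 r
| context_plusl g h1 h2 r m :
    label g = LPlus _ h1 h2 -> context g r -> computes h2 m ->
    context h1 (r `+` m)
| context_plusr g h1 h2 r m :
    label g = LPlus _ h1 h2 -> context g r -> computes h1 m ->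
    context h2 (r `+` m).

Lemma computes_context g r m :
  context g r -> computes g m -> computes (output C) (r `+` m).
Proof.
move=> cr; elim: cr m => {g r} [|g h1 h2 r lab _ IH|g h1 h2 r lab _ IH
  |g h1 h2 r m' lab _ IH cm'|g h1 h2 r m' lab _ IH cm'] m cm.
- by rewrite mset0D.
- exact: IH (computes_maxl lab cm).
- exact: IH (computes_maxr lab cm).
- rewrite -msetDA [m' `+` m]msetDC; apply: IH.
  exact: computes_plus lab cm cm'.
- by rewrite -msetDA; apply: IH; exact: computes_plus lab cm' cm.
Qed.

Lemma computes_LVar g x m : label g = LVar _ x -> computes g m -> m = [mset x].
Proof.
move=> + cm.
by case: cm => [? ? ->|? ->|? ? ? ? ->|? ? ? ? ->|? ? ? ? ? ->] // [->].
Qed.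

Lemma computes_LZero g m : label g = LZero -> computes g m -> m = mset0.
Proof.
move=> + cm.
by case: cm => [? ? ->|? ->|? ? ? ? ->|? ? ? ? ->|? ? ? ? ? ->].
Qed.

Lemma computes_LPlus g h1 h2 m : label g = LPlus _ h1 h2 -> computes g m ->
  exists m1 m2, [/\ computes h1 m1, computes h2 m2 & m = m1 `+` m2].
Proof.
move=> + cm.
case: cm => [? ? ->|? ->|? ? ? ? ->|? ? ? ? ->|? ? ? m1 m2 -> c1 c2] //.
by case=> <- <-; exists m1, m2.
Qed.

Lemma computes_variable_gate g m x :
  computes g m -> x \in m -> exists h : gate C, label h = LVar _ x.
Proof.
move=> cm; elim: cm => {g m} [g y lab|g _|g ? ? m _ _ //|g ? ? m _ _ //
  |g ? ? m1 m2 _ _ IH1 _ IH2].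
- by rewrite in_mset1 => /eqP->; exists g.
- by rewrite in_mset0.
- by rewrite in_msetD => /orP[/IH1|/IH2].
Qed.

(* This holds when [h = k], and when [h] is an input of a max gate [k]. *)
Definition rectangle k h : Prop :=
  forall r m, context k r -> computes h m -> computes (output C) (r `+` m).

Definition factors_through k h m : Prop :=
  exists r m', [/\ context k r, computes h m' & m = r `+` m'].

End Contexts.

Section Supports.
Local Open Scope mset_scope.
Variable V : finType.

Definition support (f : {mset V} -> Prop) : {set V} :=
  [set v | `[< exists2 m, f m & v \in m >]].

Lemma supportP (f : {mset V} -> Prop) v :
  reflect (exists2 m, f m & v \in m) (v \in support f).
Proof. by rewrite inE; exact: asboolP. Qed.

Lemma in_support (f : {mset V} -> Prop) m v : f m -> v \in m -> v \in support f.
Proof. by move=> fm vm; apply/supportP; exists m. Qed.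

Variable C : circuit V.
Implicit Types g h k : gate C.

Definition gate_support h : {set V} := support (computes h).
Definition context_support k : {set V} := support (@context V C k).

Lemma gate_support_LVar g x :
  label g = LVar _ x -> gate_support g \subset [set x].
Proof.
move=> lab; apply/subsetP => v /supportP[m /(computes_LVar lab)->].
by rewrite in_mset1 inE.
Qed.

Lemma gate_support_LZero g : label g = LZero -> gate_support g = set0.
Proof.
move=> lab; apply/eqP; rewrite -subset0; apply/subsetP => v.
by move=> /supportP[m /(computes_LZero lab)->]; rewrite in_mset0.
Qed.

Lemma gate_support_LPlus g h1 h2 : label g = LPlus _ h1 h2 ->
  gate_support g \subset gate_support h1 :|: gate_support h2.
Proof.
move=> lab; apply/subsetP => v.
move=> /supportP[m /(computes_LPlus lab)[m1 [m2 [c1 c2 ->]]]].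
rewrite in_msetD in_setU; case/orP=> [/(in_support c1) v1|/(in_support c2) v2].
  by rewrite [v \in gate_support h1]v1.
by rewrite [v \in gate_support h2]v2 orbT.
Qed.

Lemma factors_through_support k h m v : factors_through k h m ->
  v \in m -> v \in gate_support h :|: context_support k.
Proof.
move=> [r [m' [cr cm ->]]]; rewrite in_msetD in_setU.
case/orP=> [/(in_support cr) vr|/(in_support cm) vm].
  by rewrite [v \in context_support k]vr orbT.
by rewrite [v \in gate_support h]vm.
Qed.

Lemma in_mset_of_set (S : {set V}) v : (v \in mset_of_set S) = (v \in S).
Proof. by rewrite in_mset mset_seqE -has_count has_pred1 mem_enum. Qed.

Lemma mset_of_set_le1 (S : {set V}) v : mset_of_set S v <= 1.
Proof. by rewrite mset_seqE count_uniq_mem ?enum_uniq ?leq_b1. Qed.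

End Supports.

(** * Balanced factorizations in a circuit for independent sets *)

Lemma independent_set0 (G : sgraph) : independent (set0 : {set G}).
Proof. by move=> u v; rewrite inE. Qed.

Lemma independent_set1 (G : sgraph) (v : G) : independent [set v].
Proof. by move=> x y /set1P-> /set1P->; rewrite adj_irrefl. Qed.

Section Descent.
Local Open Scope mset_scope.
Variables (G : sgraph) (C : circuit G).
Hypothesis independent_monomials : forall m, computes (output C) m ->
  exists2 S : {set G}, independent S & m = mset_of_set S.
Implicit Types (g h k : gate C) (m r : {mset G}).

Lemma rectangle_separation k h :
  rectangle k h -> separation (gate_support h) (context_support k).
Proof.
move=> rect; split=> [|u v /supportP[m cm um] /supportP[r cr vr]].
  apply/pred0P => v /=; apply/negP.
  move=> /andP[/supportP[m cm vm] /supportP[r cr vr]].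
  have [S _ eqS] := independent_monomials (rect r m cr cm).
  have := mset_of_set_le1 S v; rewrite -eqS msetE2.
  by move: vm vr; rewrite !in_mset; lia.
have [S indS eqS] := independent_monomials (rect r m cr cm).
by apply: indS; rewrite -in_mset_of_set -eqS in_msetD ?um ?vr ?orbT.
Qed.

Variable W : {set G}.
Hypothesis W_gt1 : 1 < #|W|.

Definition balanced_factorization m : Prop := exists k h,
  balanced_separation W (gate_support h) (context_support k) /\
  factors_through k h m.

Lemma light_LVar g x : label g = LVar _ x -> light W (gate_support g).
Proof.
move=> /gate_support_LVar lab; rewrite /light.
have := subset_leq_card (subset_trans (subsetIl _ W) lab).
rewrite cards1; lia.
Qed.

Lemma light_LZero g : label g = LZero -> light W (gate_support g).
Proof. by move=> /gate_support_LZero lab; rewrite /light lab set0I cards0. Qed.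

Lemma balanced_factorization_max g h r m :
  (forall r', context g r' -> context h r') -> context g r -> computes h m ->
  ~~ light W (gate_support g) ->
  (~~ light W (gate_support h) -> balanced_factorization (r `+` m)) ->
  balanced_factorization (r `+` m).
Proof.
move=> gh cr cm heavy_g heavy_case.
have [light_h|/heavy_case//] := boolP (light W (gate_support h)).
exists g, h; split; last by exists r, m.
have [dis _] := rectangle_separation (@computes_context _ _ g).
split=> //.
  by apply: rectangle_separation => r' m' /gh; exact: computes_context.
have := leq_card_setI_disjoint W dis; move: heavy_g; rewrite /light; lia.
Qed.

Lemma balanced_factorization_gate h r m : context h r -> computes h m ->
  #|W| <= 3 * #|gate_support h :&: W| -> light W (gate_support h) ->
  balanced_factorization (r `+` m).
Proof.
move=> cr cm ge_third light_h; exists h, h; split; last by exists r, m.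
have sep := rectangle_separation (@computes_context _ _ h).
by split=> //; have := leq_card_setI_disjoint W sep.1; rewrite /light; lia.
Qed.

Lemma heavy_LPlus g h1 h2 : label g = LPlus _ h1 h2 ->
  ~~ light W (gate_support g) ->
  (#|W| <= 3 * #|gate_support h1 :&: W|) ||
  (#|W| <= 3 * #|gate_support h2 :&: W|).
Proof.
move=> lab; rewrite /light.
have := subset_leq_card (setSI W (gate_support_LPlus lab)); rewrite setIUl.
move=> /leq_trans/(_ (leq_card_setU _ _)); lia.
Qed.

(* The monomial is followed down its parse tree, into the heavier summand at a
   [+] gate, for as long as the gate still sees more than two thirds of [W]. *)
Lemma balanced_descent g m r : computes g m -> context g r ->
  ~~ light W (gate_support g) -> balanced_factorization (r `+` m).
Proof.
move=> cm; elim: cm r => {g m}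
  [g x lab|g lab|g h1 h2 m lab cm IH|g h1 h2 m lab cm IH
  |g h1 h2 m1 m2 lab cm1 IH1 cm2 IH2] r cr heavy.
- by rewrite (light_LVar lab) in heavy.
- by rewrite (light_LZero lab) in heavy.
- have cr1 : context h1 r by exact: context_maxl lab cr.
  apply: (balanced_factorization_max _ cr cm heavy (IH r cr1)) => r'.
  exact: context_maxl lab.
- have cr2 : context h2 r by exact: context_maxr lab cr.
  apply: (balanced_factorization_max _ cr cm heavy (IH r cr2)) => r'.
  exact: context_maxr lab.
have cr1 : context h1 (r `+` m2) by exact: context_plusl lab cr cm2.
have cr2 : context h2 (r `+` m1) by exact: context_plusr lab cr cm1.
have regroup1 : r `+` (m1 `+` m2) = (r `+` m2) `+` m1.
  by rewrite [m1 `+` m2]msetDC msetDA.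
have regroup2 : r `+` (m1 `+` m2) = (r `+` m1) `+` m2 by rewrite msetDA.
have [light1|heavy1] := boolP (light W (gate_support h1)); last first.
  by rewrite regroup1; exact: IH1.
have [light2|heavy2] := boolP (light W (gate_support h2)); last first.
  by rewrite regroup2; exact: IH2.
have /orP[third1|third2] := heavy_LPlus lab heavy.
  by rewrite regroup1; exact: balanced_factorization_gate cr1 cm1 third1 light1.
by rewrite regroup2; exact: balanced_factorization_gate cr2 cm2 third2 light2.
Qed.

End Descent.

Section MWISCircuits.
Variables (G : sgraph) (C : circuit G).
Hypothesis mwis : is_MWIS_circuit C.

Lemma mwis_output_variable (v : G) :
  exists2 m, computes (output C) m & v \in m.
Proof.
have [_ complete] := mwis; exists (mset_of_set [set v]).
  exact/complete/independent_set1.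
by rewrite in_mset_of_set set11.
Qed.

Lemma mwis_leq_card_num_gates : #|G| <= num_gates C.
Proof.
have /choice[var_gate var_gateP] (v : G) :
    exists g : gate C, label g = LVar _ v.
  by have [m cm /(computes_variable_gate cm)] := mwis_output_variable v.
apply: (@leq_card _ _ var_gate) => u v eq_uv.
by have := var_gateP u; rewrite eq_uv var_gateP => -[].
Qed.

Lemma mwis_avoided_separators (W : {set G}) s : 1 < #|W| ->
  (forall A B, balanced_separation W A B -> s < #|~: (A :|: B)|) ->
  exists S : gate C * gate C -> {set G}, forall I : {set G}, independent I ->
    exists2 p, s < #|S p| & [disjoint I & S p].
Proof.
move=> W_gt1 unbreakable; have [sound complete] := mwis.
exists (fun p => ~: (gate_support p.2 :|: context_support p.1)) => I indI.
have heavy : ~~ light W (gate_support (output C)).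
  rewrite /light (setIidPr _); first by lia.
  by apply/subsetP => v _; apply/supportP; exact: mwis_output_variable.
have [k [h [bal factor]]] := balanced_descent sound W_gt1
  (complete I indI) (context_output C) heavy.
exists (k, h); first exact: unbreakable.
rewrite disjoints_subset setCK; apply/subsetP => v vI.
apply: factors_through_support factor _.
by rewrite mset0D in_mset_of_set.
Qed.

End MWISCircuits.

Local Open Scope ring_scope.

(** * The hard-core partition function *)

Section HardCore.
Variables (R : numDomainType) (G : sgraph) (lambda : R).
Hypothesis lambda_ge0 : 0 <= lambda.
Implicit Types X Y S I J : {set G}.

Definition neighbors (v : G) : {set G} := [set u | adj v u].

Definition independent_subsets X : {set {set G}} :=
  [set I : {set G} | (I \subset X) && `[< independent I >]].

Lemma independent_subsetsP X I :
  reflect (I \subset X /\ independent I) (I \in independent_subsets X).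
Proof.
by rewrite inE; apply: (iffP andP) => -[sIX indI]; split=> //; apply/asboolP.
Qed.

Lemma independent_subsets_setD1 (v : G) X I :
  (I \in independent_subsets (X :\ v)) =
  (I \in independent_subsets X) && (v \notin I).
Proof. by rewrite !inE subsetD1 andbAC. Qed.

Lemma independent_setU1 (v : G) J : v \notin J ->
  independent (v |: J) <-> independent J /\ [disjoint J & neighbors v].
Proof.
move=> vJ; split=> [ind|[ind dis] x y].
  split=> [x y xJ yJ|]; first by apply: ind; rewrite !inE ?xJ ?yJ orbT.
  apply/pred0P => x /=; apply/negP => /andP[xJ]; rewrite inE.
  by apply/negP/ind; rewrite !inE ?eqxx // xJ orbT.
rewrite !inE => /predU1P[->|xJ] /predU1P[->|yJ].
- by rewrite adj_irrefl.
- by have := disjointFr dis yJ; rewrite inE => ->.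
- by have := disjointFr dis xJ; rewrite inE adj_sym => ->.
- exact: ind.
Qed.

Lemma independent_subsets_setU1 (v : G) X J : v \in X -> v \notin J ->
  (v |: J \in independent_subsets X) =
  (J \in independent_subsets ((X :\ v) :\: neighbors v)).
Proof.
move=> vX vJ; apply/independent_subsetsP/independent_subsetsP.
  rewrite subUset sub1set vX /= => -[sJX /(independent_setU1 vJ)[indJ dis]].
  by rewrite subsetD subsetD1 sJX vJ.
rewrite subsetD subsetD1 => -[/andP[/andP[sJX _] dis] indJ].
split; first by rewrite subUset sub1set vX.
exact/(independent_setU1 vJ).
Qed.

Definition hard_core X : R := \sum_(I in independent_subsets X) lambda ^+ #|I|.

Lemma hard_core_gt0 X : 0 < hard_core X.
Proof.
rewrite /hard_core (bigD1 set0) /=; last first.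
  apply/independent_subsetsP.
  by split; [exact: sub0set | exact: independent_set0].
by rewrite cards0 expr0 ltr_pwDl // sumr_ge0 // => I _; rewrite exprn_ge0.
Qed.

Lemma hard_core_subset X Y : X \subset Y -> hard_core X <= hard_core Y.
Proof.
move=> sXY; rewrite /hard_core [leLHS]big_mkcond [leRHS]big_mkcond /=.
apply: ler_sum => I _; case: ifP => [|_]; last by case: ifP; rewrite ?exprn_ge0.
rewrite !inE => /andP[sIX ->].
by rewrite (subset_trans sIX sXY).
Qed.

Lemma hard_core_setD1 (v : G) X : v \in X ->
  hard_core X =
  hard_core (X :\ v) + lambda * hard_core ((X :\ v) :\: neighbors v).
Proof.
move=> vX; rewrite [RHS]addrC /hard_core.
rewrite (bigID (fun I : {set G} => v \in I)) /=.
congr (_ + _); last by apply: eq_bigl => I; rewrite independent_subsets_setD1.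
rewrite (reindex_onto (fun J => v |: J) (fun I => I :\ v)) /=; last first.
  by move=> I /andP[_ vI]; rewrite setD1K.
rewrite mulr_sumr; apply: eq_big => [J|J /andP[_ /eqP eqJ]]; last first.
  by rewrite cardsU1 -exprS; have -> : v \notin J by rewrite -eqJ !inE eqxx.
rewrite setU11 andbT; have [vJ|vJ] := boolP (v \in J); last first.
  by rewrite independent_subsets_setU1 // setU1K // eqxx andbT.
have -> : ((v |: J) :\ v == J) = false.
  by apply/negbTE/eqP => /setP/(_ v); rewrite !inE eqxx vJ.
by rewrite andbF inE subsetD subsetD1 vJ !andbF.
Qed.

Lemma hard_core_le_setD1 (v : G) X :
  hard_core X <= (1 + lambda) * hard_core (X :\ v).
Proof.
have [vX|vX] := boolP (v \in X); last first.
  have -> : X :\ v = X by apply/setDidPl; rewrite disjoint_sym disjoints1.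
  by rewrite ler_peMl ?lerDl // ltW ?hard_core_gt0.
rewrite (hard_core_setD1 vX) mulrDl mul1r lerD2l ler_wpM2l //.
exact/hard_core_subset/subsetDl.
Qed.

Lemma hard_core_le_setD S X :
  hard_core X <= (1 + lambda) ^+ #|S| * hard_core (X :\: S).
Proof.
elim/setU1_ind: S => [|v S vS IHS]; first by rewrite cards0 expr0 mul1r setD0.
apply: le_trans IHS _; rewrite cardsU1 vS exprSr -mulrA setUC -setDDl.
by rewrite ler_wpM2l ?exprn_ge0 ?addr_ge0 // hard_core_le_setD1.
Qed.

Variable q : R.
Hypothesis q_ge0 : 0 <= q.
Hypothesis q_le : q * (1 + lambda) ^+ max_degree G <= lambda.

Lemma hard_core_ge_setD1 (v : G) X : v \in X ->
  (1 + q) * hard_core (X :\ v) <= hard_core X.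
Proof.
move=> vX; rewrite (hard_core_setD1 vX) mulrDl mul1r lerD2l.
apply: le_trans (ler_wpM2l q_ge0 (hard_core_le_setD (neighbors v) _)) _.
rewrite mulrA ler_wpM2r ?(ltW (hard_core_gt0 _)) //.
apply: le_trans _ q_le; rewrite ler_wpM2l // ler_weXn2l ?lerDl //.
exact: (@leq_bigmax _ (@degree G)).
Qed.

Lemma hard_core_ge_setD S X : S \subset X ->
  (1 + q) ^+ #|S| * hard_core (X :\: S) <= hard_core X.
Proof.
elim/setU1_ind: S => [|v S vS IHS]; first by rewrite cards0 expr0 mul1r setD0.
rewrite subUset sub1set => /andP[vX sSX]; apply: le_trans _ (IHS sSX).
rewrite cardsU1 vS exprSr -mulrA setUC -setDDl.
by rewrite ler_wpM2l ?exprn_ge0 ?addr_ge0 ?hard_core_ge_setD1 // inE vS.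
Qed.

(* Weighting independent sets by the hard-core measure, those avoiding a given
   [S] have total weight at most [(1 + q) ^- #|S|]. *)
Lemma avoiding_family_card (P : finType) (S : P -> {set G}) k :
  (forall I, independent I ->
     exists2 p, (k <= #|S p|)%N & [disjoint I & S p]) ->
  (1 + q) ^+ k <= #|P|%:R.
Proof.
move=> avoided; have Z_gt0 := hard_core_gt0 [set: G].
have cover : hard_core [set: G] <=
    \sum_(p | (k <= #|S p|)%N) hard_core ([set: G] :\: S p).
  rewrite /hard_core (exchange_big_dep (mem (independent_subsets setT))) /=;
    last by move=> p I _; rewrite !inE subsetT => /andP[].
  apply: ler_sum => I /independent_subsetsP[_ indI].
  have [p le_kS dis] := avoided I indI; rewrite (bigD1 p) /=; last first.
    by rewrite le_kS; apply/independent_subsetsP; rewrite subsetD subsetT.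
  by rewrite lerDl sumr_ge0 // => ? _; rewrite exprn_ge0.
have avoid_le p : (k <= #|S p|)%N ->
    (1 + q) ^+ k * hard_core ([set: G] :\: S p) <= hard_core [set: G].
  move=> le_kS; apply: le_trans _ (hard_core_ge_setD (subsetT (S p))).
  apply: ler_wpM2r; first exact/ltW/hard_core_gt0.
  by rewrite ler_weXn2l ?lerDl.
rewrite -(ler_pM2r Z_gt0).
apply: le_trans (ler_wpM2l (exprn_ge0 k (addr_ge0 ler01 q_ge0)) cover) _.
rewrite mulr_sumr; apply: le_trans (ler_sum _ avoid_le) _.
rewrite sumr_const mulr_natl.
exact: ler_wpMn2l (ltW Z_gt0) _ _ (max_card _).
Qed.

End HardCore.

(** * Choice of the fugacity *)

Section Estimates.
Variable R : realType.
Implicit Types a q t x : R.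

Lemma powR_le1D a t : 0 < a -> 0 <= t <= 1 -> a `^ t <= 1 + t * (a - 1).
Proof.
move=> a_gt0 /andP[t_ge0 t_le1].
have convex :
    expR (t * ln a + (1 - t) * 0) <= t * expR (ln a) + (1 - t) * expR 0 :=
  convex_expR (Itv01 t_ge0 t_le1) (ln a) 0.
rewrite mulr0 addr0 lnK // expR0 in convex.
rewrite /powR gt_eqF //; apply: le_trans convex _; lra.
Qed.

Lemma exprD1n_le x n : 0 <= x -> x *+ n < 1 -> (1 + x) ^+ n <= (1 - x *+ n)^-1.
Proof.
move=> x_ge0 xn_lt1; apply: (@le_trans _ _ (expR (x *+ n))).
  rewrite -mulr_natl expRM_natl lerXn2r ?nnegrE ?expR_ge0 ?expR_ge1Dx //.
  exact: addr_ge0.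
rewrite -[leLHS]invrK -expRN lef_pV2 ?posrE ?expR_gt0 ?subr_gt0 //.
exact: expR_ge1Dx.
Qed.

Lemma hard_core_rate (d : nat) : (0 < d)%N ->
  (4 * d%:R)^-1 * (1 + (2 * d%:R)^-1) ^+ d <= (2 * d%:R)^-1 :> R.
Proof.
move=> d_gt0; have dR : 1 <= d%:R :> R by rewrite ler1n.
set lambda := (2 * d%:R)^-1.
have lambda_gt0 : 0 < lambda by rewrite invr_gt0; lra.
have lambda_d : lambda *+ d = 2^-1 by rewrite -mulr_natr /lambda; field; lra.
have le2 : (1 + lambda) ^+ d <= 2.
  apply: le_trans (exprD1n_le (ltW lambda_gt0) _) _; rewrite lambda_d.
    lra.
  by rewrite invf_ple ?posrE; lra.
have -> : (4 * d%:R)^-1 = lambda / 2 by rewrite /lambda; field; lra.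
by rewrite -mulrA ler_piMr ?(ltW lambda_gt0) //; lra.
Qed.

Lemma powR2_le_exprD1 (d k w : nat) : (0 < d)%N -> (w <= 4 * k)%N ->
  2 `^ (w%:R / (16 * d%:R)) <= (1 + (4 * d%:R)^-1) ^+ k :> R.
Proof.
move=> d_gt0 le_wk; have dR : 1 <= d%:R :> R by rewrite ler1n.
set q := (4 * d%:R)^-1 : R; have q_gt0 : 0 < q by rewrite invr_gt0; lra.
have q_le1 : q <= 1 by rewrite invf_le1; lra.
have base : 2 `^ q <= 1 + q.
  apply: le_trans (powR_le1D _ _) _; [by [] | | lra].
  by rewrite ltW.
apply: (@le_trans _ _ ((2 `^ q) ^+ k)); last first.
  by rewrite lerXn2r ?nnegrE ?powR_ge0 // addr_ge0 // ltW.
rewrite -powR_mulrn ?powR_ge0 // -powRrM ler_powR //; first lra.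
have -> : q * k%:R = (4 * k)%:R / (16 * d%:R) by rewrite natrM /q; field; lra.
by rewrite ler_wpM2r ?ler_nat // invr_ge0; lra.
Qed.

End Estimates.

Lemma degree_lt_card (G : sgraph) (v : G) : (degree v < #|G|)%N.
Proof.
rewrite -cardsT; apply: proper_card; apply/properP; split; first exact: subsetT.
by exists v; rewrite inE ?adj_irrefl.
Qed.

Lemma max_degree_le_predn_card (G : sgraph) : (max_degree G <= #|G|.-1)%N.
Proof. by apply/bigmax_leqP => v _; have := degree_lt_card v; lia. Qed.

Lemma mwis_num_gates_lower_bound (R : realType) (G : sgraph) (w : nat)
    (C : circuit G) :
  is_treewidth G w -> (0 < max_degree G)%N -> (4 < w)%N -> is_MWIS_circuit C ->
  2 `^ (w%:R / (16 * (max_degree G)%:R)) <= (num_gates C ^ 2)%:R :> R.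
Proof.
move=> tw; set d := max_degree G => d_gt0 w_gt4 mwis; pose s := (w.-1 %/ 4)%N.
have lt_sw : (4 * s < w)%N by lia.
have [W cardW unbreakable] := treewidth_unbreakable_set tw lt_sw.
have [|S avoided] := mwis_avoided_separators mwis _ unbreakable; first by lia.
have inv_ge0 n : 0 <= (n%:R * d%:R)^-1 :> R by rewrite invr_ge0 mulr_ge0.
apply: le_trans (powR2_le_exprD1 R d_gt0 (_ : w <= 4 * s.+1)%N) _; first by lia.
have rate := hard_core_rate R d_gt0.
have := avoiding_family_card (inv_ge0 2) (inv_ge0 4) rate avoided.
by rewrite card_prod.
Qed.

Theorem theorem1 (R : realType) :
  exists c : R, 0 < c /\
    forall (G : sgraph) (w d : nat),
      is_treewidth G w -> max_degree G = d -> (1 <= d)%N ->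
      forall C : circuit G, is_MWIS_circuit C ->
        2 `^ (c * w%:R / d%:R) <= (num_gates C)%:R.
Proof.
exists 32^-1; split=> [|G w d tw degG d_gt0 C mwis]; first by rewrite invr_gt0.
have dR : 1 <= d%:R :> R by rewrite ler1n.
have [w_le4|w_gt4] := leqP w 4.
  apply: (@le_trans _ _ 2); last first.
    rewrite ler_nat; have := mwis_leq_card_num_gates mwis.
    by have := max_degree_le_predn_card G; lia.
  rewrite -[leRHS]powRr1 // ler_powR //; first lra.
  have wR : w%:R <= 4 :> R by rewrite ler_nat.
  by rewrite ler_pdivrMr; lra.
rewrite -degG in d_gt0 *.
have := mwis_num_gates_lower_bound R tw d_gt0 w_gt4 mwis.
have -> : w%:R / (16 * (max_degree G)%:R) =
    32^-1 * w%:R / (max_degree G)%:R * 2%:R :> R.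
  by field; rewrite pnatr_eq0 -lt0n.
rewrite (powRrM _ _ 2) powR_mulrn ?powR_ge0 // natrX.
by rewrite ler_pXn2r ?nnegrE ?powR_ge0.
Qed.
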